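(* Let $m\ge 1$, $L\ge 1$ and let $\mathcal{C}=\{A_1,\dots,A_L\}$ be a set of real symmetric $m\times m$ matrices. (i) For any $n\ge m$, the set $\mathcal{C}$ is $\mathbf{T}_{m,n}$-SDO if and only if it is SDO. (ii) For any $n\ge m$, the set $\mathcal{C}$ is $\mathbf{T}_{m,n}$-SD if and only if it is SD.
   Context: $\mathrm{SL}_m(\mathbb{R})$ is the group of real $m\times m$ matrices with determinant $1$, and $\mathrm{SO}_m\subseteq \mathrm{SL}_m(\mathbb{R})$ is the special orthogonal group. For $n\ge m$, $\mathrm{St}(m,n)=\{P\in\mathbb{R}^{n\times m}: P^{\mathsf T}P=I_m\}$ and $\mathrm{RSL}(m,n)=\{P\in\mathbb{R}^{n\times m}: P^{\mathsf T}P\in \mathrm{SL}_m(\mathbb{R})\}$. The set $\mathcal{C}$ is SD (simultaneously diagonalizable) if there is $P\in\mathrm{SL}_m(\mathbb{R})$ such that $P^{\mathsf T}A_iP$ is diagonal for all $i$; it is SDO if there is $P\in\mathrm{SO}_m$ such that $P^{\mathsf T}A_iP$ is diagonal for all $i$. The set $\mathcal{C}$ is $\mathbf{T}_{m,n}$-SDO (respectively $\mathbf{T}_{m,n}$-SD) if there is $P\in\mathrm{St}(m,n)$ (respectively $P\in\mathrm{RSL}(m,n)$) such that the $n\times n$ matrix $PA_iP^{\mathsf T}$ is diagonal for all $1\le i\le L$. *)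

(* Defs.v *)
From HB Require Import structures.
From mathcomp Require Import all_boot all_order all_algebra.
From mathcomp Require Import reals.

Set Implicit Arguments.
Unset Strict Implicit.
Unset Printing Implicit Defensive.

Import Order.TTheory GRing.Theory Num.Theory.
Local Open Scope ring_scope.

Definition SL (R : realType) (m : nat) : {pred 'M[R]_m} :=
  [pred P | \det P == 1].
Arguments SL R m : clear implicits.

Definition SO (R : realType) (m : nat) : {pred 'M[R]_m} :=
  [pred P | (P^T *m P == 1%:M) && (P \in SL R m)].
Arguments SO R m : clear implicits.

Definition St (R : realType) (m n : nat) : {pred 'M[R]_(n, m)} :=
  [pred P | P^T *m P == 1%:M].
Arguments St R m n : clear implicits.

Definition RSL (R : realType) (m n : nat) : {pred 'M[R]_(n, m)} :=
  [pred P | P^T *m P \in SL R m].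
Arguments RSL R m n : clear implicits.

Definition SD (R : realType) (m L : nat) (A : 'I_L -> 'M[R]_m) : Prop :=
  exists2 P : 'M[R]_m, P \in SL R m &
    forall i : 'I_L, is_diag_mx (P^T *m A i *m P).

Definition SDO (R : realType) (m L : nat) (A : 'I_L -> 'M[R]_m) : Prop :=
  exists2 P : 'M[R]_m, P \in SO R m &
    forall i : 'I_L, is_diag_mx (P^T *m A i *m P).

Definition T_SDO (R : realType) (m n L : nat) (A : 'I_L -> 'M[R]_m) : Prop :=
  exists2 P : 'M[R]_(n, m), P \in St R m n &
    forall i : 'I_L, is_diag_mx (P *m A i *m P^T).

Definition T_SD (R : realType) (m n L : nat) (A : 'I_L -> 'M[R]_m) : Prop :=
  exists2 P : 'M[R]_(n, m), P \in RSL R m n &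
    forall i : 'I_L, is_diag_mx (P *m A i *m P^T).

Arguments T_SDO {R m} n {L} A.
Arguments T_SD {R m} n {L} A.

(* Main.v *)
Require Import Defs.
From HB Require Import structures.
From mathcomp Require Import all_boot all_order all_algebra.
From mathcomp Require Import reals.

Set Implicit Arguments.
Unset Strict Implicit.
Unset Printing Implicit Defensive.

Import Order.TTheory GRing.Theory Num.Theory.
Local Open Scope ring_scope.

(** Suppose that [G = P^T P] is invertible and that every [D_i = P A_i P^T] is
    diagonal.  The matrix [Pi = P G^-1 P^T] is the orthogonal projector onto
    the column space of [P]; as [Pi P = P], multiplication by [Pi] on either
    side leaves [D_i] unchanged, so the two commute.  Each coordinate vector
    is a common eigenvector of the diagonal matrices [D_i], so its image under
    [Pi] is one too, unless it vanishes.  These images span the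
    range of [Pi], and Gram-Schmidt can be carried out without leaving the set of common eigenvectors, because the
    projector onto the span of some orthonormal common eigenvectors commutes
    with every [D_i] again (lemma [orthonormal_eigenrows]).  This gives [m]
    orthonormal rows [U] in the range of [Pi] with [U D_i = Lambda_i U],
    [Lambda_i] diagonal.

    Put [Q = U P], a square matrix.  Then [Q A_i Q^T = U D_i U^T = Lambda_i] and
    [Q G^-1 Q^T = U Pi U^T = 1] (lemma [square_congruence]).  The second
    identity says that [Q] is orthogonal when [G = 1], and that [det Q] is [1]
    or [-1] when [det G = 1]; rescaling one row by [det Q] makes the
    determinant equal to [1].  So [Q^T] witnesses SDO, respectively SD.

    Conversely, the transpose of a square witness is padded with zero rows. *)

Lemma is_diag_mulmx (R : pzRingType) (m n p : nat)
    (A : 'M[R]_(m, n)) (B : 'M[R]_(n, p)) :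
  is_diag_mx A -> is_diag_mx B -> is_diag_mx (A *m B).
Proof.
move=> /is_diag_mxP dA /is_diag_mxP dB; apply/is_diag_mxP => i j ij.
rewrite mxE big1 // => k _.
have [ik|ik] := eqVneq (i : nat) k; last by rewrite dA // mul0r.
by rewrite dB ?mulr0 // -ik.
Qed.

Lemma is_diag_pid_mx (R : pzRingType) (m n r : nat) :
  is_diag_mx (pid_mx r : 'M[R]_(m, n)).
Proof. by apply/is_diag_mxP => i j /negPf ij; rewrite mxE ij. Qed.

Lemma row_sqnorm_gt0 (R : realDomainType) (n : nat) (v : 'rV[R]_n) :
  v != 0 -> 0 < (v *m v^T) 0 0.
Proof.
move=> /rV0Pn[j vj]; rewrite mxE (bigD1 j) //= mxE.
apply: ltr_pwDl; first by rewrite -expr2 exprn_even_gt0.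
by apply: sumr_ge0 => k _; rewrite mxE -expr2 sqr_ge0.
Qed.

(** Gram-Schmidt inside the set of common eigenvectors: the next vector is a
    nonzero row of [Pi - U^T U], the projector onto the part of the range of
    [Pi] orthogonal to the rows already found.  That projector commutes with
    each [D i], so row [r] of it is an eigenvector with eigenvalue [D i r r]. *)
Lemma orthonormal_eigenrows (R : rcfType) (n : nat) (I : Type)
    (D : I -> 'M[R]_n) (Pi : 'M[R]_n) (k : nat) :
    (forall i, is_diag_mx (D i)) -> (forall i, Pi *m D i = D i *m Pi) ->
    Pi^T = Pi -> Pi *m Pi = Pi -> (k <= \rank Pi)%N ->
  exists U : 'M[R]_(k, n), [/\ U *m U^T = 1%:M, U *m Pi = U &
    forall i, exists d : 'rV[R]_k, U *m D i = diag_mx d *m U].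
Proof.
move=> diagD commD symPi idPi; elim: k => [_|k IHk ltk].
  exists 0; split; [by apply/matrixP; case | exact: mul0mx |].
  by move=> i; exists 0; rewrite mul0mx mulmx0.
have [U [UU UPi eigU]] := IHk (ltnW ltk).
have symD i : (D i)^T = D i.
  by have [d ->] := diag_mxP _ (diagD i); rewrite tr_diag_mx.
have PiU : Pi *m U^T = U^T by rewrite -{1}symPi -trmx_mul UPi.
have commU i : U^T *m U *m D i = D i *m (U^T *m U).
  have [d eU] := eigU i.
  have eUT : D i *m U^T = U^T *m diag_mx d.
    by rewrite -{1}symD -trmx_mul eU trmx_mul tr_diag_mx.
  by rewrite -mulmxA eU !mulmxA eUT.
pose N := Pi - U^T *m U.
have commN i : N *m D i = D i *m N.
  by rewrite mulmxBl mulmxBr commD commU.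
have N_neq0 : N != 0.
  apply: contraTneq ltk => /eqP; rewrite subr_eq0 -leqNgt => /eqP ->.
  exact: leq_trans (mxrankM_maxr _ _) (rank_leq_row _).
have [r [c Nrc]] := matrix0Pn _ N_neq0.
pose w := row r N; pose s := (Num.sqrt ((w *m w^T) 0 0))^-1.
pose v := s *: w.
have w_neq0 : w != 0 by apply/rV0Pn; exists c; rewrite mxE.
have wU : w *m U^T = 0.
  by rewrite /w -row_mul mulmxBl PiU -mulmxA UU mulmx1 subrr row0.
have wPi : w *m Pi = w.
  by rewrite /w -row_mul mulmxBl idPi -mulmxA UPi.
have eigw i : w *m D i = D i r r *: w.
  rewrite /w -row_mul commN; have [d ->] := diag_mxP _ (diagD i).
  by apply/rowP => j; rewrite mul_diag_mx !mxE eqxx mulr1n.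
have vU : v *m U^T = 0 by rewrite -scalemxAl wU scaler0.
have vv : v *m v^T = 1%:M.
  have ww_gt0 := row_sqnorm_gt0 w_neq0.
  rewrite [v *m _]mx11_scalar; congr _%:M.
  rewrite /v linearZ /= -scalemxAl -scalemxAr scalerA mxE /s -invfM -expr2.
  by rewrite sqr_sqrtr ?ltW // mulVf ?gt_eqF.
rewrite -[k.+1]/(1 + k)%N; exists (col_mx v U); split.
- rewrite tr_col_mx mul_col_row vv UU vU.
  by rewrite -[U *m v^T]trmxK trmx_mul trmxK vU trmx0 -scalar_mx_block.
- by rewrite mul_col_mx UPi -scalemxAl wPi.
- move=> i; have [d eU] := eigU i; exists (row_mx (D i r r)%:M d).
  rewrite mul_col_mx eU diag_mx_row mul_block_col !mul0mx addr0 add0r.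
  congr col_mx; rewrite -scalemxAl eigw.
  have -> : diag_mx (D i r r)%:M = (D i r r)%:M :> 'M_1.
    by apply/matrixP=> a b; rewrite !ord1 !mxE.
  by rewrite mul_scalar_mx scalerA mulrC -scalerA.
Qed.

(** Invertibility of the Gram matrix of [P] is exactly what the projector onto
    the column space needs; both Stiefel and determinant-one Gram matrices are
    covered, and the identity on [Q] specialises to each. *)
Lemma square_congruence (R : rcfType) (m n : nat) (I : Type)
    (A : I -> 'M[R]_m) (P : 'M[R]_(n, m)) :
    P^T *m P \in unitmx -> (forall i, is_diag_mx (P *m A i *m P^T)) ->
  exists2 Q : 'M[R]_m, Q *m invmx (P^T *m P) *m Q^T = 1%:M &
    forall i, is_diag_mx (Q *m A i *m Q^T).
Proof.
set G := P^T *m P => unitG diagD.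
pose Pi := P *m invmx G *m P^T.
have PiP : Pi *m P = P by rewrite -mulmxA -/G mulmxKV.
have PPi : P^T *m Pi = P^T by rewrite !mulmxA -/G mulmxV // mul1mx.
have symG : G^T = G by rewrite trmx_mul trmxK.
have symPi : Pi^T = Pi by rewrite !trmx_mul trmxK trmx_inv symG mulmxA.
have idPi : Pi *m Pi = Pi by rewrite {2}/Pi !mulmxA PiP.
have commD i : Pi *m (P *m A i *m P^T) = P *m A i *m P^T *m Pi.
  by rewrite -[RHS]mulmxA PPi !mulmxA PiP.
have rankPi : (m <= \rank Pi)%N.
  apply: (@leq_trans (\rank G)); first by rewrite mxrank_unit.
  rewrite /G -{1}PPi -mulmxA.
  exact: leq_trans (mxrankM_maxr _ _) (mxrankM_maxl _ _).
have [U [UU UPi eigU]] := orthonormal_eigenrows diagD commD symPi idPi rankPi.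
exists (U *m P).
  transitivity (U *m Pi *m U^T); last by rewrite UPi.
  by rewrite trmx_mul !mulmxA.
move=> i; have [d eU] := eigU i.
rewrite trmx_mul.
have -> : U *m P *m A i *m (P^T *m U^T) = U *m (P *m A i *m P^T) *m U^T.
  by rewrite !mulmxA.
by rewrite eU -mulmxA UU mulmx1 diag_mx_is_diag.
Qed.

(** As [det Q] squares to [1], multiplying the first row by it is a diagonal
    isometry, which repairs the orientation and keeps congruences diagonal. *)
Lemma orientation_fix (R : comPzRingType) (m : nat) (Q : 'M[R]_m) :
    (0 < m)%N -> \det Q ^+ 2 = 1 ->
  exists S : 'M[R]_m, [/\ is_diag_mx S, S *m S^T = 1%:M & \det (S *m Q) = 1].
Proof.
case: m Q => // m Q _ detQ2.
pose d : 'rV[R]_m.+1 := \row_j (if j == 0 then \det Q else 1).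
exists (diag_mx d); split; first exact: diag_mx_is_diag.
  rewrite tr_diag_mx mulmx_diag -diag_const_mx; congr diag_mx.
  by apply/rowP => j; rewrite !mxE; case: eqP => _; rewrite ?mulr1 -?expr2.
rewrite det_mulmx det_diag big_ord_recl mxE eqxx big1 ?mulr1 -?expr2 //.
by move=> j _; rewrite mxE.
Qed.

(** The common forward direction: the identity on [Q] is [Q^T Q = 1] when [P]
    has orthonormal columns, so one witness serves both orthogonal and general
    congruence. *)
Lemma unimodular_congruence (R : rcfType) (m n : nat) (I : Type)
    (A : I -> 'M[R]_m) (P : 'M[R]_(n, m)) :
    (0 < m)%N -> \det (P^T *m P) = 1 ->
    (forall i, is_diag_mx (P *m A i *m P^T)) ->
  exists Q : 'M[R]_m, [/\ \det Q = 1, Q^T *m invmx (P^T *m P) *m Q = 1%:M &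
    forall i, is_diag_mx (Q^T *m A i *m Q)].
Proof.
move=> m_gt0 detG diagD.
have unitG : P^T *m P \in unitmx by rewrite unitmxE detG unitr1.
have [Q QGQ diagQ] := square_congruence unitG diagD.
have detQ2 : \det Q ^+ 2 = 1.
  move/(congr1 determinant): QGQ.
  by rewrite !det_mulmx det_inv detG invr1 mulr1 det_tr det1 expr2.
have [S [diagS SS detSQ]] := orientation_fix m_gt0 detQ2.
exists (S *m Q)^T; rewrite det_tr trmxK trmx_mul.
split=> // [|i].
  have -> : S *m Q *m invmx (P^T *m P) *m (Q^T *m S^T)
    = S *m (Q *m invmx (P^T *m P) *m Q^T) *m S^T by rewrite !mulmxA.
  by rewrite QGQ mulmx1.
have -> : S *m Q *m A i *m (Q^T *m S^T) = S *m (Q *m A i *m Q^T) *m S^T.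
  by rewrite !mulmxA.
by apply: is_diag_mulmx; [apply: is_diag_mulmx | rewrite is_diag_trmx].
Qed.

(** Zero-padding: [pid_mx m] is the isometric inclusion of the first [m]
    coordinates. *)
Lemma tall_congruence (R : comPzRingType) (m n : nat) (Q : 'M[R]_m) :
    (m <= n)%N ->
  exists2 P : 'M[R]_(n, m), P^T *m P = Q *m Q^T &
    forall A, is_diag_mx (Q^T *m A *m Q) -> is_diag_mx (P *m A *m P^T).
Proof.
move=> le_mn; pose E : 'M[R]_(n, m) := pid_mx m.
have EE : E^T *m E = 1%:M by rewrite tr_pid_mx pid_mx_id // pid_mx_1.
exists (E *m Q^T); rewrite trmx_mul trmxK.
  by rewrite mulmxA -(mulmxA Q) EE mulmx1.
move=> A diagA.
have -> : E *m Q^T *m A *m (Q *m E^T) = E *m (Q^T *m A *m Q) *m E^T.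
  by rewrite !mulmxA.
apply: is_diag_mulmx; last by rewrite tr_pid_mx is_diag_pid_mx.
by apply: is_diag_mulmx; first exact: is_diag_pid_mx.
Qed.

Theorem theorem3p2 (R : realType) (m L : nat) (hm : (1 <= m)%N) (hL : (1 <= L)%N)
    (A : 'I_L -> 'M[R]_m) (hA : forall i : 'I_L, (A i)^T = A i) :
  (forall n : nat, (m <= n)%N -> (T_SDO n A <-> SDO A)) /\
  (forall n : nat, (m <= n)%N -> (T_SD n A <-> SD A)).
Proof.
split=> n le_mn; split=> -[P hP diagP].
- move: hP; rewrite inE => /eqP PP.
  have detG : \det (P^T *m P) = 1 by rewrite PP det1.
  have [Q [detQ QGQ diagQ]] := unimodular_congruence hm detG diagP.
  exists Q => //; rewrite !inE detQ eqxx andbT.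
  by move: QGQ; rewrite PP invmx1 mulmx1 => ->.
- move: hP; rewrite inE => /andP[/eqP PP _].
  have [Q QQ diagQ] := tall_congruence P le_mn.
  by exists Q => [|i]; [rewrite inE QQ mulmx1C | exact: diagQ].
- move: hP; rewrite !inE => /eqP detG.
  have [Q [detQ _ diagQ]] := unimodular_congruence hm detG diagP.
  by exists Q; rewrite ?inE ?detQ.
- move: hP; rewrite inE => /eqP detP.
  have [Q QQ diagQ] := tall_congruence P le_mn.
  exists Q => [|i]; last exact: diagQ.
  by rewrite !inE QQ det_mulmx det_tr detP mulr1.
Qed.
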